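(* In the one-dimensional setting of the context, assume in addition that the walk is uniformly elliptic and $\mathbb{E}[\log(p^-/p^+)]\le0$. Then for all $x\in[-1,1]$, $I(x)=J(x)$, where $$I(x)=\sup_{\lambda\in\mathbb{R}}\{\lambda x-\Lambda(\lambda)\},\qquad J(x)=\begin{cases}\sup_{r\in\mathbb{R}}\{r-x\,g(r)\}, & 0\le x\le1,\\ \sup_{r\in\mathbb{R}}\{r+x\,h(r)\}, & -1\le x\le 0.\end{cases}$$
   Context: Let $(\Omega,\mathcal{F},\mathbb{P})$ be a probability space with an invertible ergodic measure-preserving transformation $T$, and $p^+,p^-:\Omega\to[0,1]$ measurable with $p^++p^-=1$; uniform ellipticity means $0<a\le p^{\pm}\le b<1$ $\mathbb{P}$-a.s. for constants $a,b$. $P_\omega$ is the law of the walk $(X_n)$ on $\mathbb{Z}$, $X_0=0$, stepping from $x$ to $x+1$ with probability $p^+(T^x\omega)$ and to $x-1$ with probability $p^-(T^x\omega)$. Let $\tau_1=\inf\{n:X_n=1\}$, $\tau_{-1}=\inf\{n:X_n=-1\}$, $G(\omega,r)=E^{P_\omega}[\mathrm{e}^{r\tau_1}1_{\{\tau_1<\infty\}}]$, $H(\omega,r)=E^{P_\omega}[\mathrm{e}^{r\tau_{-1}}1_{\{\tau_{-1}<\infty\}}]$, $g(r)=\mathbb{E}[\log G(\omega,r)]$, $h(r)=\mathbb{E}[\log H(\omega,r)]$. The class $\mathcal{K}$ consists of pairs $F^\pm\in L^1(\mathbb{P})$ with $\mathbb{E}[F^\pm]=0$ and $F^+(\omega)+F^-(T\omega)=0$,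 and $$\Lambda(\lambda)=\inf_{F\in\mathcal{K}}\operatorname*{ess\,sup}_\omega\log\left\{p^+\mathrm{e}^{\lambda+F^+}+p^-\mathrm{e}^{-\lambda+F^-}\right\}.$$ *)

(* Defs.v *)
From HB Require Import structures.
From mathcomp Require Import all_boot all_order all_algebra.
From mathcomp Require Import all_classical all_reals all_analysis ess_sup_inf.
Set Implicit Arguments. Unset Strict Implicit. Unset Printing Implicit Defensive.
Import Order.TTheory GRing.Theory Num.Theory.
Import numFieldNormedType.Exports.
Local Open Scope classical_set_scope.
Local Open Scope ring_scope.

Section RWRE.
Context {R : realType} {d : measure_display} {Omega : measurableType d}.

Definition Tpow (T Tinv : Omega -> Omega) (z : int) : Omega -> Omega :=
  match z with Posz n => iter n T | Negz n => iter n.+1 Tinv end.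

Definition wpos n (s : n.-tuple bool) (k : nat) : int :=
  \sum_(i < k) (if nth false s i then 1 else -1).

Definition path_weight (pp pm : Omega -> R) (T Tinv : Omega -> Omega)
    n (s : n.-tuple bool) (w : Omega) : R :=
  \prod_(i < n) (let y := Tpow T Tinv (wpos s i) w in
                 if tnth s i then pp y else pm y).

Definition first_hit (z : int) n (s : n.-tuple bool) : bool :=
  (wpos s n == z) && [forall k : 'I_n, wpos s k != z].

Definition hit_prob pp pm T Tinv (z : int) (n : nat) (w : Omega) : R :=
  \sum_(s : n.-tuple bool | first_hit z s) path_weight pp pm T Tinv s w.

(* E^{P_omega}[e^{r tau_z} 1_{tau_z < oo}] = sum_n e^{r n} P_omega(tau_z = n) *)
Definition hit_mgf pp pm T Tinv (z : int) (w : Omega) (r : R) : \bar R :=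
  (\sum_(n <oo) ((expR (r * n%:R) * hit_prob pp pm T Tinv z n w)%:E))%E.

Definition elog (x : \bar R) : \bar R :=
  match x with
  | EFin r => if 0 < r then (ln r)%:E else -oo%E
  | +oo%E => +oo%E
  | -oo%E => -oo%E
  end.

Definition gz (P : probability Omega R) pp pm T Tinv (z : int) (r : R) : \bar R :=
  (\int[P]_w elog (hit_mgf pp pm T Tinv z w r))%E.

Definition classK (P : probability Omega R) (T : Omega -> Omega)
    : set ((Omega -> R) * (Omega -> R)) :=
  [set F | [/\ P.-integrable setT (EFin \o F.1),
              P.-integrable setT (EFin \o F.2),
              (\int[P]_w (F.1 w)%:E = 0)%E,
              (\int[P]_w (F.2 w)%:E = 0)%E &
              {ae P, forall w, F.1 w + F.2 (T w) = 0}]].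

Definition Lambda (P : probability Omega R) pp pm T (lam : R) : \bar R :=
  ereal_inf [set ess_sup P (fun w => (ln (pp w * expR (lam + F.1 w)
                                        + pm w * expR (- lam + F.2 w)))%:E)
            | F in classK P T].

Definition Irate (P : probability Omega R) pp pm T (x : R) : \bar R :=
  ereal_sup [set ((lam * x)%:E - Lambda P pp pm T lam)%E | lam in [set: R]].

(* Convention: a term r - x g(r) (resp. r + x h(r)) with g(r) (resp. h(r))
   not finite counts as -oo. *)
Definition Jrate (P : probability Omega R) pp pm T Tinv (x : R) : \bar R :=
  if 0 <= x then
    ereal_sup [set (let g := gz P pp pm T Tinv 1 r in
                    if g \is a fin_num then (r - x * fine g)%:E else -oo)%E
              | r in [set: R]]
  else
    ereal_sup [set (let h := gz P pp pm T Tinv (-1) r in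
                    if h \is a fin_num then (r + x * fine h)%:E else -oo)%E
              | r in [set: R]].

End RWRE.

(* Main.v *)
(* Put u = e^(lambda + F^+); since F^-(w) = - F^+(T^-1 w), the bound
   Lambda(lambda) <= -r says, up to approximation, that some u > 0 with
   E[log u] = lambda satisfies e^r (p^+ u + p^- / (u o T^-1)) <= 1. Such a u
   gives a positive function V on the orbit, V(x+1)/V(x) = u(T^x w), for which
   e^(r n) V(X_n) is a supermartingale; stopping at tau_1 and tau_{-1} yields
   G <= 1/u and H <= u o T^-1, hence h(r) <= lambda <= -g(r). Conversely, 1/G
   and H o T are admissible choices of u as soon as g(r), resp. h(r), is finite,
   so Lambda(-g(r)) <= -r and Lambda(h(r)) <= -r. Both suprema are therefore
   suprema of r + lambda x over the same extremal pairs (r, lambda). *)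
Require Import Defs.
From HB Require Import structures.
From mathcomp Require Import all_boot all_order all_algebra.
From mathcomp Require Import all_classical all_reals all_analysis ess_sup_inf.
From mathcomp Require Import measurable_realfun lra.
Import Order.TTheory GRing.Theory Num.Theory.
Import numFieldNormedType.Exports.
Local Open Scope classical_set_scope.
Local Open Scope ring_scope.

(** * Nearest-neighbour paths: splitting off the first step *)

Lemma big_tuple_cons {R : pzSemiRingType} n (A : finType)
    (Q : pred (n.+1.-tuple A)) (F : n.+1.-tuple A -> R) :
  \sum_(s | Q s) F s =
  \sum_(b : A) \sum_(t : n.-tuple A | Q [tuple of b :: t]) F [tuple of b :: t].
Proof.
rewrite pair_big_dep /=.
rewrite (reindex (fun u : A * n.-tuple A => [tuple of u.1 :: u.2])) //=.
exists (fun s => (thead s, [tuple of behead s])) => [[b t]|s] _ /=.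
  by congr pair; apply: val_inj.
by rewrite [RHS]tuple_eta; apply: val_inj.
Qed.

Lemma wpos_cons n b (t : n.-tuple bool) k :
  wpos [tuple of b :: t] k.+1 = (if b then 1 else -1) + wpos t k.
Proof. by rewrite /wpos big_ord_recl. Qed.

Lemma wpos0 n (s : n.-tuple bool) : wpos s 0 = 0.
Proof. by rewrite /wpos big_ord0. Qed.

(** A path starts at 0, so a nonempty path can hit 0 for the first time only at time 0, which forces
    [z != 0]. For other targets the first step merely translates the target. *)
Lemma first_hit_cons z n b (t : n.-tuple bool) :
  first_hit z [tuple of b :: t] =
  (z != 0) && first_hit (z - (if b then 1 else -1)) t.
Proof.
rewrite /first_hit wpos_cons.
have E k : ((if b then 1 else -1) + wpos t k == z) =
           (wpos t k == z - (if b then 1 else -1)).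
  by rewrite [RHS]eq_sym subr_eq eq_sym addrC.
rewrite E [RHS]andbCA; congr andb; apply/forallP/andP => [h|[z0 /forallP h] k].
  split; first by have := h ord0; rewrite wpos0 eq_sym.
  by apply/forallP => k; have := h (lift ord0 k); rewrite lift0 wpos_cons E.
case: (unliftP ord0 k) => [j ->|->]; first by rewrite lift0 wpos_cons E.
by rewrite wpos0 eq_sym.
Qed.

Section walk.
Context {d : measure_display} {Omega : measurableType d}.
Implicit Types T Tinv : Omega -> Omega.

(** [Tpow] is defined by cases on the sign of the exponent, so for negative [z] one [Tinv] has to be
    cancelled against [T]. *)
Lemma TpowD1 T Tinv z w : cancel T Tinv -> Tpow T Tinv (1 + z) w = Tpow T Tinv z (T w).
Proof.
move=> TK; case: z => [n|[|n]].
- by rewrite /Tpow -PoszD add1n iterSr.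
- by rewrite /= TK.
- have -> : 1 + Negz n.+1 = Negz n :> int by rewrite !NegzE -[n.+2]add1n PoszD; lra.
  by rewrite /Tpow [in RHS]iterSr TK.
Qed.

Lemma TpowN T Tinv z : Tpow T Tinv (- z) =1 Tpow Tinv T z.
Proof. by case: z => [[|n]|n]. Qed.

Lemma TpowB1 T Tinv z w : cancel Tinv T -> Tpow T Tinv (-1 + z) w = Tpow T Tinv z (Tinv w).
Proof.
move=> TK; rewrite -[z]opprK -opprD !(TpowN T); exact: TpowD1.
Qed.

End walk.

(** * Hitting probabilities as a recursion on time and distance *)

Section hitting.
Context {R : realType} {d : measure_display} {Omega : measurableType d}.
Implicit Types (p q : Omega -> R) (S Sinv : Omega -> Omega) (r : R) (w : Omega).

Lemma hit_prob0 p q S Sinv z w : hit_prob p q S Sinv z 0 w = (z == 0)%:R.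
Proof.
rewrite /hit_prob /first_hit.
rewrite (eq_bigl (fun s => z == 0)); last first.
  move=> s; rewrite wpos0 eq_sym andb_idr// => _.
  by apply/forallP => -[].
case: (z == 0); last by rewrite big_pred0.
rewrite (big_pred1 [tuple]) /=; last by move=> s; rewrite [s]tuple0; apply/esym/eqP; apply: val_inj.
by rewrite /path_weight big_ord0.
Qed.

(** Markov property at time 1: the rest of the path is again a walk from 0, in the environment
    shifted by [S] or [Sinv], with the target moved accordingly. *)
Lemma hit_probS p q S Sinv z n w : cancel S Sinv -> cancel Sinv S ->
  hit_prob p q S Sinv z n.+1 w =
  if z == 0 then 0 else
  p w * hit_prob p q S Sinv (z - 1) n (S w) +
  q w * hit_prob p q S Sinv (z + 1) n (Sinv w).
Proof.
move=> SK SinvK; rewrite /hit_prob big_tuple_cons big_bool /=.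
have [->|z0] := eqVneq z 0.
  by rewrite !big_pred0 ?addr0// => t; rewrite first_hit_cons eqxx.
rewrite !mulr_sumr; congr +%R; apply: eq_big => [t|t _].
- by rewrite first_hit_cons z0.
- rewrite /path_weight big_ord_recl wpos0; congr (_ * _).
  apply: eq_bigr => i _; rewrite lift0 wpos_cons TpowD1//.
  by rewrite !(tnth_nth false).
- by rewrite first_hit_cons z0 opprK.
- rewrite /path_weight big_ord_recl wpos0; congr (_ * _).
  apply: eq_bigr => i _; rewrite lift0 wpos_cons TpowB1//.
  by rewrite !(tnth_nth false).
Qed.

(* The probability of first reaching distance [z] in the direction of [S] at
   time [n]; swapping [p] with [q] and [S] with [Sinv] reflects the walk, so
   that both of [G] and [H] are instances. *)
Fixpoint fwd_hit_prob p q S Sinv (n z : nat) w : R :=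
  match n, z with
  | 0, _ => (z == 0)%N%:R
  | _.+1, 0 => 0
  | n.+1, z.+1 => p w * fwd_hit_prob p q S Sinv n z (S w) +
                  q w * fwd_hit_prob p q S Sinv n z.+2 (Sinv w)
  end.

Lemma hit_prob_fwd p q S Sinv n z w : cancel S Sinv -> cancel Sinv S ->
  hit_prob p q S Sinv z%:Z n w = fwd_hit_prob p q S Sinv n z w.
Proof.
move=> SK SinvK; elim: n z w => [|n IH] z w; first by rewrite hit_prob0.
rewrite hit_probS//; case: z => [//|z] /=.
have -> : z.+1%:Z - 1 = z%:Z by rewrite -addn1 PoszD addrK.
have -> : z.+1%:Z + 1 = z.+2%:Z by rewrite -PoszD addn1.
by rewrite !IH.
Qed.

Lemma hit_prob_bwd p q S Sinv n z w : cancel S Sinv -> cancel Sinv S ->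
  hit_prob p q S Sinv (- z%:Z) n w = fwd_hit_prob q p Sinv S n z w.
Proof.
move=> SK SinvK; elim: n z w => [|n IH] z w; first by rewrite hit_prob0 oppr_eq0.
rewrite hit_probS//; case: z => [//|z] /=.
have -> : - z.+1%:Z - 1 = - z.+2%:Z by rewrite -[z.+2]addn1 PoszD opprD.
have -> : - z.+1%:Z + 1 = - z%:Z by rewrite -addn1 PoszD opprD addrNK.
by rewrite !IH addrC.
Qed.

End hitting.

(** * Generating functions of passage times and supermartingale bounds *)

Section generating_function.
Context {R : realType} {d : measure_display} {Omega : measurableType d}.
Context (p q : Omega -> R) (S Sinv : Omega -> Omega) (r : R).
Implicit Types (n N M z : nat) (w : Omega).
Hypothesis p0 : forall w, 0 <= p w.
Hypothesis q0 : forall w, 0 <= q w.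

Local Notation hitp := (fwd_hit_prob p q S Sinv).

Lemma fwd_hit_prob_ge0 n z w : 0 <= hitp n z w.
Proof.
elim: n z w => [|n IH] [|z] w //=.
by rewrite addr_ge0// mulr_ge0.
Qed.

(** Cutting the series at times below [N] keeps every quantity real and allows induction on the
    horizon; [fwd_mgf] is the limit at distance 1. *)
Definition trunc_mgf N z w : R := \sum_(n < N) expR (r * n%:R) * hitp n z w.

Definition fwd_mgf w : \bar R :=
  (\sum_(n <oo) (expR (r * n%:R) * hitp n 1 w)%:E)%E.

Lemma trunc_mgf_ge0 N z w : 0 <= trunc_mgf N z w.
Proof.
by apply: sumr_ge0 => i _; rewrite mulr_ge0 ?expR_ge0 ?fwd_hit_prob_ge0.
Qed.

Lemma trunc_mgf00 z w : trunc_mgf 0 z w = 0.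
Proof. by rewrite /trunc_mgf big_ord0. Qed.

Lemma trunc_mgfS0 N w : trunc_mgf N.+1 0 w = 1.
Proof.
rewrite /trunc_mgf big_ord_recl /= !mulr0 expR0 mulr1 big1 ?addr0// => i _.
by rewrite mulr0.
Qed.

Lemma trunc_mgfSS N z w : trunc_mgf N.+1 z.+1 w =
  expR r * (p w * trunc_mgf N z (S w) + q w * trunc_mgf N z.+2 (Sinv w)).
Proof.
rewrite /trunc_mgf big_ord_recl /= mulr0 add0r.
rewrite [p w * _]mulr_sumr [q w * _]mulr_sumr -big_split mulr_sumr /=.
apply: eq_bigr => i _; rewrite /bump add1n add0n -natr1 [r * _]mulrDr mulr1 expRD.
by rewrite [_ * expR r]mulrC -mulrA mulrDr !(mulrCA (expR (r * _))).
Qed.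

Lemma trunc_mgf_nd N M z w : (N <= M)%N -> trunc_mgf N z w <= trunc_mgf M z w.
Proof.
move=> /subnK <-; elim: (M - N)%N => // k IH.
apply: le_trans IH _; rewrite addSn /trunc_mgf big_ord_recr /= lerDl.
by rewrite mulr_ge0 ?expR_ge0 ?fwd_hit_prob_ge0.
Qed.

(* Strong Markov property at the first visit of distance [z]: only this
   inequality is needed, which avoids the Cauchy product. *)
Lemma trunc_mgfM M N z w : cancel S Sinv -> cancel Sinv S ->
  trunc_mgf M z w * trunc_mgf N 1 (iter z S w) <= trunc_mgf (M + N) z.+1 w.
Proof.
move=> SK SinvK; elim: M z w => [|M IH] z w.
  by rewrite trunc_mgf00 mul0r trunc_mgf_ge0.
case: z => [|z].
  by rewrite trunc_mgfS0 mul1r /= trunc_mgf_nd// leq_addl.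
rewrite addSn !trunc_mgfSS -mulrA ler_wpM2l ?expR_ge0// mulrDl -!mulrA.
rewrite lerD// ler_wpM2l//; first by rewrite iterSr IH.
(* After a step away from the target the walk sits at [Sinv w], at distance [z.+2]; moving forward
   by that distance reaches the same environment as before, so the second factor is unchanged. *)
have := IH z.+2 (Sinv w).
by rewrite iterSr SinvK.
Qed.

Lemma trunc_mgf_cvg w : (trunc_mgf N 1 w)%:E @[N --> \oo] --> fwd_mgf w.
Proof.
have -> : (fun N => (trunc_mgf N 1 w)%:E) =
    (fun N => \sum_(0 <= n < N) (expR (r * n%:R) * hitp n 1 w)%:E)%E.
  by apply/funext => N; rewrite big_mkord sumEFin.
apply: is_cvg_nneseries => n _ _.
by rewrite lee_fin mulr_ge0 ?expR_ge0 ?fwd_hit_prob_ge0.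
Qed.

Lemma le_fwd_mgf N w : ((trunc_mgf N 1 w)%:E <= fwd_mgf w)%E.
Proof.
rewrite -(cvg_lim _ (trunc_mgf_cvg w))//; apply: lime_ge.
  by apply/cvg_ex; eexists; exact: trunc_mgf_cvg.
by near=> M; rewrite lee_fin trunc_mgf_nd//; near: M; exists N.
Unshelve. all: by end_near. Qed.

Lemma fwd_mgf_le c w : (forall N, trunc_mgf N 1 w <= c) -> (fwd_mgf w <= c%:E)%E.
Proof.
move=> h; rewrite -(cvg_lim _ (trunc_mgf_cvg w))//; apply: lime_le.
  by apply/cvg_ex; eexists; exact: trunc_mgf_cvg.
by near=> M; rewrite lee_fin.
Unshelve. all: by end_near. Qed.

(** Only the path that hits at its first step is kept. Under ellipticity this bounds the logarithm
    from below. *)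
Lemma fwd_mgf_ge_step w : ((expR r * p w)%:E <= fwd_mgf w)%E.
Proof.
apply: le_trans (le_fwd_mgf 2 w); rewrite lee_fin trunc_mgfSS trunc_mgfS0.
by rewrite mulr1 mulrDr lerDl !mulr_ge0 ?expR_ge0 ?trunc_mgf_ge0.
Qed.

(** One half of the recursion G = e^r (p + q G(Sinv) G): after a step back, the walk has to cross
    two unit distances, from [Sinv w] to [w] and from [w] to [S w]. *)
Lemma fwd_mgf_rec w x y : cancel S Sinv -> cancel Sinv S ->
  fwd_mgf w = x%:E -> fwd_mgf (Sinv w) = y%:E ->
  expR r * (p w + q w * (y * x)) <= x.
Proof.
move=> SK SinvK wx wy.
have := @trunc_mgf_cvg w; rewrite wx => /fine_cvgP[_ cx].
have := @trunc_mgf_cvg (Sinv w); rewrite wy => /fine_cvgP[_ cy].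
have c : expR r * (p w + q w *
    (trunc_mgf N 1 (Sinv w) * trunc_mgf N 1 w)) @[N --> \oo] -->
    expR r * (p w + q w * (y * x)).
  apply: cvgM; first exact: cvg_cst.
  apply: cvgD; first exact: cvg_cst.
  apply: cvgM; first exact: cvg_cst.
  exact: cvgM.
rewrite -(cvg_lim _ c)//; apply: limr_le; first by apply/cvg_ex; eexists; exact: c.
near=> N.
(* At distance 0 the truncated sum is 1 only if it contains the term of time 0. *)
have N0 : (0 < N)%N by near: N; exists 1%N.
(* The horizon leaves room for one step followed by two passages, each of time below [N]. *)
rewrite -lee_fin -wx; apply: le_trans (le_fwd_mgf (N + N).+1 w).
rewrite lee_fin trunc_mgfSS ler_wpM2l ?expR_ge0//.
have -> : trunc_mgf (N + N) 0 (S w) = 1 by rewrite -(prednK N0) trunc_mgfS0.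
rewrite mulr1 lerD2l ler_wpM2l//.
have := trunc_mgfM N N 1 (Sinv w) SK SinvK.
by rewrite /= SinvK.
Unshelve. all: by end_near. Qed.

(* Along the walk, e^(rn) V with V = \prod_(j < z) u (S^j w) at distance z from
   the target is a supermartingale, stopped at the target, where V = 1. *)
Lemma trunc_mgf_super (u : Omega -> R) (A : set Omega) :
  cancel Sinv S -> (forall w, 0 < u w) ->
  (forall w, A w -> A (S w)) -> (forall w, A w -> A (Sinv w)) ->
  (forall w, A w -> expR r * (p w * u w + q w / u (Sinv w)) <= 1) ->
  forall N z w, A w -> trunc_mgf N z w * \prod_(j < z) u (iter j S w) <= 1.
Proof.
move=> SinvK u0 AS ASinv Au; elim => [|N IH] [|z] w Aw.
- by rewrite trunc_mgf00 mul0r ler01.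
- by rewrite trunc_mgf00 mul0r ler01.
- by rewrite trunc_mgfS0 big_ord0 mulr1.
apply: le_trans (Au _ Aw).
rewrite trunc_mgfSS -mulrA ler_wpM2l ?expR_ge0// mulrDl -!mulrA.
rewrite lerD// ler_wpM2l//.
  rewrite big_ord_recl mulrCA ger_pMr//.
  under eq_bigr do rewrite lift0 iterSr.
  exact/IH/AS.
(* The product that starts at [Sinv w] has the extra first factor [u (Sinv w)]; multiplying by it
   makes the induction hypothesis at distance [z.+2] applicable. *)
rewrite -[leRHS]div1r ler_pdivlMr ?u0// -mulrA -[_ * u (Sinv w)]mulrC.
have := IH z.+2 _ (ASinv _ Aw); rewrite big_ord_recl.
by under eq_bigr do rewrite lift0 iterSr SinvK.
Qed.

(** This is the product bound at distance 1, uniform in the horizon. The invariant set [A] is there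
    because the inequality must hold at every site visited, while it will be known only almost
    surely. *)
Lemma fwd_mgf_super (u : Omega -> R) (A : set Omega) w :
  cancel Sinv S -> (forall w, 0 < u w) ->
  (forall w, A w -> A (S w)) -> (forall w, A w -> A (Sinv w)) ->
  (forall w, A w -> expR r * (p w * u w + q w / u (Sinv w)) <= 1) ->
  A w -> (fwd_mgf w <= (u w)^-1%:E)%E.
Proof.
move=> SinvK u0 AS ASinv Au Aw; apply: fwd_mgf_le => N.
have := @trunc_mgf_super u A SinvK u0 AS ASinv Au N 1%N w Aw.
by rewrite big_ord_recl big_ord0 mulr1 /= -[X in _ -> _ <= X]mul1r ler_pdivlMr.
Qed.

End generating_function.

(** * Almost sure statements and integrals under measure-preserving maps *)

Section measure_preserving.
Context {R : realType} {d : measure_display} {Omega : measurableType d}.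
Context (P : probability Omega R).
Implicit Types (S : Omega -> Omega) (f : Omega -> \bar R).

Lemma ae_measure_preserving S (A : set Omega) : measurable_fun setT S ->
  (forall B, measurable B -> P (S @^-1` B) = P B) ->
  {ae P, forall w, A w} -> {ae P, forall w, A (S w)}.
Proof.
move=> mS PS [B [mB PB0 AB]]; exists (S @^-1` B); split.
- by rewrite -[_ @^-1` _]setTI; exact: mS.
- by rewrite -PB0; exact: PS.
- by move=> w nA; exact: (AB (S w)).
Qed.

Lemma ae_iter S (A : set Omega) : measurable_fun setT S ->
  (forall B, measurable B -> P (S @^-1` B) = P B) ->
  {ae P, forall w, A w} -> {ae P, forall w, forall n, A (iter n S w)}.
Proof.
move=> mS PS PA; apply/ae_foralln => n; elim: n => [//|n IH].
have := @ae_measure_preserving S _ mS PS IH.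
by apply: filterS => w /=; rewrite -iterS iterSr.
Qed.

Lemma ge0_integral_measure_preserving S f : measurable_fun setT S ->
  (forall B, measurable B -> P (S @^-1` B) = P B) ->
  measurable_fun setT f -> (forall w, 0 <= f w)%E ->
  (\int[P]_w f (S w) = \int[P]_w f w)%E.
Proof.
move=> mS PS mf f0; rewrite -(@ge0_integral_pushforward _ _ _ _ _ S mS P setT f)//.
by apply: eq_measure_integral => A mA _; exact: PS.
Qed.

Lemma integrable_measure_preserving S f : measurable_fun setT S ->
  (forall B, measurable B -> P (S @^-1` B) = P B) ->
  P.-integrable setT f -> P.-integrable setT (f \o S).
Proof.
move=> mS PS /integrableP[mf foo]; apply/integrableP; split.
  exact: measurableT_comp.
rewrite (@ge0_integral_measure_preserving S (fun w => `|f w|%E))//.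
exact: measurableT_comp.
Qed.

Lemma integral_measure_preserving S f : measurable_fun setT S ->
  (forall B, measurable B -> P (S @^-1` B) = P B) ->
  P.-integrable setT f -> (\int[P]_w f (S w) = \int[P]_w f w)%E.
Proof.
move=> mS PS fi; rewrite -(@integral_pushforward _ _ _ _ _ S mS P setT f)//.
- by apply: eq_measure_integral => A mA _; exact: PS.
- by case/integrableP : fi.
- exact: integrable_measure_preserving.
Qed.

(** The integral is a difference of the integrals of the positive and negative parts, which is
    finite only if both are. *)
Lemma fin_num_integral_integrable f : measurable_fun setT f ->
  (\int[P]_w f w)%E \is a fin_num -> P.-integrable setT f.
Proof.
move=> mf; rewrite integralE fin_numB => /andP[fp fn].
apply/integrableP; split => //.
rewrite (_ : (fun w => `|f w|%E) = (f^\+ \+ f^\-)%E); last first.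
  by rewrite -fune_abse.
rewrite ge0_integralD//; [|exact: measurable_funepos|exact: measurable_funeneg].
by rewrite lte_add_pinfty// ltey_eq ?fp ?fn.
Qed.

Lemma integral_fine f : P.-integrable setT f ->
  P.-integrable setT (EFin \o (fine \o f)) /\
  (\int[P]_w (fine (f w))%:E = \int[P]_w f w)%E.
Proof.
move=> fi; have /integrableP[mf _] := fi.
have mff : measurable_fun setT (EFin \o (fine \o f)).
  by apply/measurable_EFinP; exact: measurableT_comp.
have E : (\int[P]_w (fine (f w))%:E = \int[P]_w f w)%E.
  apply: ae_eq_integral => //.
  have := integrable_ae measurableT fi.
  by apply: filterS => w /(_ I) wf _; rewrite fineK.
split => //; apply: fin_num_integral_integrable => //=.
by rewrite E integrable_fin_num.
Qed.

Lemma ae_bounded_integral f (c : R) (psi : Omega -> R) :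
  measurable_fun setT f -> P.-integrable setT (EFin \o psi) ->
  {ae P, forall w, (c%:E <= f w <= (psi w)%:E)%E} ->
  (\int[P]_w f w)%E \is a fin_num /\
  (\int[P]_w f w <= \int[P]_w (psi w)%:E)%E.
Proof.
move=> mf psii cf.
have /integrableP[/measurable_EFinP mpsi _] := psii.
(* The two bounds hold only almost surely. Clamping gives a real function equal to [f] almost
   everywhere, with k <= psi and |k| <= |c| + |psi| everywhere. *)
pose k w := Num.min (Num.max (fine (f w)) c) (psi w).
have mk : measurable_fun setT k.
  apply: measurable_minr => //; apply: measurable_maxr => //.
  exact: measurableT_comp.
have -> : (\int[P]_w f w = \int[P]_w (k w)%:E)%E.
  apply: ae_eq_integral => //; first exact/measurable_EFinP.
  apply: filterS cf => w; rewrite /k; case: (f w) => [x| |] /=.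
  - by rewrite !lee_fin => /andP[cx xpsi] _; rewrite max_l// min_l.
  - by rewrite leye_eq andbF.
  - by [].
have ki : P.-integrable setT (EFin \o k).
  apply: (@le_integrable _ _ _ _ _ measurableT _
    (fun w => `|(cst c w)%:E| + `|(psi w)%:E|)%E).
  - exact/measurable_EFinP.
  - move=> w _ /=; rewrite lee_fin [leRHS]ger0_norm ?addr_ge0// /k.
    have := ler_norm (psi w); have := ler_norm (- psi w).
    have := ler_norm c; have := ler_norm (- c); rewrite !normrN => h1 h2 h3 h4.
    rewrite ler_norml ge_min le_min le_max; apply/andP; split.
      by apply/andP; split; [apply/orP; right|]; lra.
    by apply/orP; right; lra.
  - apply: integrableD => //; apply: integrable_abse => //.
    exact: finite_measure_integrable_cst.
split; first exact: integrable_fin_num.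
apply: le_integral => // w _.
by rewrite lee_fin ge_min lexx orbT.
Qed.

End measure_preserving.

(** * The extended logarithm *)

Section elog.
Context {R : realType}.
Implicit Types x y : \bar R.

Lemma le_elog x y : (x <= y)%E -> (elog x <= elog y)%E.
Proof.
case: x => [x| |]; case: y => [y| |] //=; rewrite ?lee_fin; last first.
- by move=> _; case: ifP; rewrite ?leNye.
- by move=> _; rewrite leey.
move=> xy; case: ifP => x0; last by rewrite leNye.
have y0 : 0 < y by exact: lt_le_trans xy.
by rewrite y0 lee_fin ler_ln.
Qed.

Lemma elog_expR (r : R) : elog (expR r)%:E = r%:E.
Proof. by rewrite /= expR_gt0 expRK. Qed.

Lemma elog_fin_num x : elog x \is a fin_num -> x = (expR (fine (elog x)))%:E.
Proof.
case: x => [x| |] //=; case: ifPn => // x0 _.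
by rewrite /= lnK// posrE.
Qed.

Lemma measurable_elog : measurable_fun setT (@elog R).
Proof.
have -> : @elog R = fun x => if x == +oo%E then +oo%E else
    if (0 < x)%E then (ln (fine x))%:E else -oo%E.
  by apply/funext => -[x| |] //=.
apply: measurable_fun_ifT => //; first exact: measurable_fun_eqe.
apply: measurable_fun_ifT => //; first exact: measurable_fun_lte.
by apply/measurable_EFinP; exact: measurableT_comp.
Qed.

End elog.

(** * Supersolutions and the mean logarithm of the generating function *)

Section supersolution.
Context {R : realType} {d : measure_display} {Omega : measurableType d}.
Context (P : probability Omega R) (p q : Omega -> R) (S Sinv : Omega -> Omega).
Implicit Types (r : R) (phi : Omega -> R).
Hypothesis mS : measurable_fun setT S.
Hypothesis mSinv : measurable_fun setT Sinv.
Hypothesis SK : cancel S Sinv.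
Hypothesis SinvK : cancel Sinv S.
Hypothesis PS : forall A, measurable A -> P (S @^-1` A) = P A.
Hypothesis PSinv : forall A, measurable A -> P (Sinv @^-1` A) = P A.
Hypothesis mp : measurable_fun setT p.
Hypothesis mq : measurable_fun setT q.
Hypothesis p0 : forall w, 0 <= p w.
Hypothesis q0 : forall w, 0 <= q w.

Local Notation mgf := (fwd_mgf p q S Sinv).

Lemma measurable_fwd_hit_prob n z :
  measurable_fun setT (fwd_hit_prob p q S Sinv n z).
Proof.
elim: n z => [|n IH] [|z] //=.
by apply: measurable_funD; apply: measurable_funM => //; exact: measurableT_comp.
Qed.

Lemma measurable_elog_fwd_mgf r : measurable_fun setT (fun w => elog (mgf r w)).
Proof.
apply: (measurableT_comp measurable_elog).
apply: ge0_emeasurable_sum => [n w _ _|n _].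
  by rewrite lee_fin mulr_ge0 ?expR_ge0 ?fwd_hit_prob_ge0.
by apply/measurable_EFinP/measurable_funM => //; exact: measurable_fwd_hit_prob.
Qed.

(** With u = e^phi as supersolution, e^r a <= G <= e^(-phi) almost surely; the logarithms are then
    integrated. *)
Lemma elog_mgf_super r a phi : 0 < a ->
  {ae P, forall w, a <= p w} -> P.-integrable setT (EFin \o phi) ->
  {ae P, forall w, expR r * (p w * expR (phi w) + q w * expR (- phi (Sinv w))) <= 1} ->
  (\int[P]_w elog (mgf r w))%E \is a fin_num /\
  (\int[P]_w elog (mgf r w) <= \int[P]_w (- phi w)%:E)%E.
Proof.
move=> a0 ap phii super.
have super1 := ae_iter P S _ mS PS super.
have super2 := ae_iter P Sinv _ mSinv PSinv super.
apply: (@ae_bounded_integral _ _ _ _ _ (r + ln a) (fun w => - phi w)).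
- exact: measurable_elog_fwd_mgf.
- by have := integrableN phii; apply: eq_integrable.
pose Q w := expR r * (p w * expR (phi w) + q w * expR (- phi (Sinv w))) <= 1.
(* Environments whose whole two-sided orbit satisfies the inequality: an invariant set, of full
   measure by [super1] and [super2]. *)
pose A w := (forall n, Q (iter n S w)) /\ (forall n, Q (iter n Sinv w)).
have AS w : A w -> A (S w).
  move=> [A1 A2]; split=> n; first by rewrite -iterSr.
  case: n => [|n]; first exact: (A1 1%N).
  by rewrite iterSr SK.
have ASinv w : A w -> A (Sinv w).
  move=> [A1 A2]; split=> n; last by rewrite -iterSr.
  case: n => [|n]; first exact: (A2 1%N).
  by rewrite iterSr SinvK.
near=> w; apply/andP; split.
  rewrite -elog_expR expRD lnK ?posrE//; apply: le_elog.
  apply: le_trans (fwd_mgf_ge_step p q S Sinv r p0 q0 w).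
  by rewrite lee_fin ler_wpM2l ?expR_ge0//; near: w.
rewrite -elog_expR; apply: le_elog; rewrite expRN.
apply: (@fwd_mgf_super _ _ _ _ _ _ _ _ p0 q0 (expR \o phi) A) => //=.
- by move=> w'; exact: expR_gt0.
- by move=> w' [/(_ 0%N)/= + _]; rewrite /Q expRN.
- by split; near: w.
Unshelve. all: by end_near. Qed.

(** Take phi = - log G, that is u = 1/G. Dividing [fwd_mgf_rec] by G(w) gives the inequality
    wherever log G is finite at both [w] and [Sinv w]. *)
Lemma elog_mgf_solution r : (\int[P]_w elog (mgf r w))%E \is a fin_num ->
  exists phi, [/\ P.-integrable setT (EFin \o phi),
    (\int[P]_w (phi w)%:E = - \int[P]_w elog (mgf r w))%E &
    {ae P, forall w,
      expR r * (p w * expR (phi w) + q w * expR (- phi (Sinv w))) <= 1}].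
Proof.
move=> gfin.
have gi := fin_num_integral_integrable P _ (measurable_elog_fwd_mgf r) gfin.
have [li lE] := integral_fine P _ gi.
have lfin := integrable_ae measurableT gi.
have lfinS := ae_measure_preserving P Sinv _ mSinv PSinv lfin.
exists (fun w => - fine (elog (mgf r w))); split.
- by have := integrableN li; apply: eq_integrable.
- rewrite -lE -integralN//.
  exact: integrable_add_def.
near=> w.
have /elog_fin_num wE : elog (mgf r w) \is a fin_num.
  by apply: (near lfin w) => //.
have /elog_fin_num w'E : elog (mgf r (Sinv w)) \is a fin_num.
  by apply: (near lfinS w) => //.
have := fwd_mgf_rec p q S Sinv r p0 q0 w _ _ SK SinvK wE w'E.
rewrite opprK expRN; set x := expR (fine (elog (mgf r w))); set y := expR _.
have x0 : 0 < x by exact: expR_gt0.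
rewrite -[X in _ -> _ <= X](mulfV (lt0r_neq0 x0)) ler_pdivlMr// -mulrA mulrDl.
by rewrite -!mulrA mulVf ?gt_eqF// mulr1.
Unshelve. all: by end_near. Qed.

End supersolution.

(** * Integrals of translates and opposites *)

Section affine_integral.
Context {R : realType} {d : measure_display} {Omega : measurableType d}.
Context (P : probability Omega R).

Lemma integrable_cstD (c : R) (f : Omega -> R) :
  P.-integrable setT (EFin \o f) ->
  P.-integrable setT (EFin \o (fun w => c + f w)) /\
  (\int[P]_w (c + f w)%:E = c%:E + \int[P]_w (f w)%:E)%E.
Proof.
move=> fi.
have ci : P.-integrable setT (EFin \o cst c).
  exact: finite_measure_integrable_cst.
split; first by have := integrableD measurableT ci fi; apply: eq_integrable.
under eq_integral do rewrite EFinD.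
rewrite (integralD_EFin measurableT ci fi); congr (_ + _)%E.
by rewrite (integral_cst P measurableT c%:E) /= probability_setT mule1.
Qed.

Lemma integrable_opp (f : Omega -> R) :
  P.-integrable setT (EFin \o f) ->
  P.-integrable setT (EFin \o (fun w => - f w)) /\
  (\int[P]_w (- f w)%:E = - \int[P]_w (f w)%:E)%E.
Proof.
move=> fi; split.
  by have := integrableN fi; apply: eq_integrable.
rewrite -integralN//.
exact: integrable_add_def.
Qed.

End affine_integral.

(** * From correctors in the class K to g and h, and back *)

Section rate_functions.
Context {R : realType} {d : measure_display} {Omega : measurableType d}.
Context (P : probability Omega R) (T Tinv : Omega -> Omega) (pp pm : Omega -> R).
Hypothesis mT : measurable_fun setT T.
Hypothesis mTinv : measurable_fun setT Tinv.
Hypothesis TK : cancel T Tinv.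
Hypothesis TinvK : cancel Tinv T.
Hypothesis PT : forall A, measurable A -> P (T @^-1` A) = P A.
Hypothesis mpp : measurable_fun setT pp.
Hypothesis mpm : measurable_fun setT pm.
Hypothesis pp0 : forall w, 0 <= pp w.
Hypothesis pm0 : forall w, 0 <= pm w.

Let PTinv A : measurable A -> P (Tinv @^-1` A) = P A.
Proof.
move=> mA; rewrite -PT; last by rewrite -[_ @^-1` _]setTI; exact: mTinv.
by congr (P _); apply/seteqP; split => w /=; rewrite TK.
Qed.

Lemma gz_fwd r : gz P pp pm T Tinv 1 r =
  (\int[P]_w elog (fwd_mgf pp pm T Tinv r w))%E.
Proof.
apply: eq_integral => w _; congr elog; apply: eq_eseriesr => n _.
by rewrite -(hit_prob_fwd pp pm T Tinv n 1 w TK TinvK).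
Qed.

Lemma gz_bwd r : gz P pp pm T Tinv (-1) r =
  (\int[P]_w elog (fwd_mgf pm pp Tinv T r w))%E.
Proof.
apply: eq_integral => w _; congr elog; apply: eq_eseriesr => n _.
by rewrite -(hit_prob_bwd pp pm T Tinv n 1 w TK TinvK).
Qed.

(** The rightward passage uses phi = lam + F^+, the leftward one phi = - lam + F^-. The cocycle
    relation makes the two supersolution inequalities one and the same, and centring gives phi the
    means lam and - lam. *)
Lemma gz_super a lam r F : 0 < a -> {ae P, forall w, a <= pp w /\ a <= pm w} ->
  classK P T F ->
  {ae P, forall w, ln (pp w * expR (lam + F.1 w) + pm w * expR (- lam + F.2 w))
                   <= - r} ->
  [/\ gz P pp pm T Tinv 1 r \is a fin_num,
      (gz P pp pm T Tinv 1 r <= (- lam)%:E)%E,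
      gz P pp pm T Tinv (-1) r \is a fin_num &
      (gz P pp pm T Tinv (-1) r <= lam%:E)%E].
Proof.
move=> a0 ap [F1i F2i F1E F2E F12] Fr.
have F12' := ae_measure_preserving P Tinv _ mTinv PTinv F12.
have super : {ae P, forall w, expR r *
    (pp w * expR (lam + F.1 w) + pm w * expR (- lam + F.2 w)) <= 1}.
  (* Exponentiating the bound on [ln] requires a positive argument, which [0 < pp w] provides. *)
  near=> w.
  have ppw : 0 < pp w by apply: lt_le_trans a0 _; near: w; apply: filterS ap => ? [].
  rewrite mulrC -ler_pdivlMr ?expR_gt0// div1r -expRN -ler_ln ?posrE ?expR_gt0//.
    by rewrite expRK; near: w.
  by rewrite ltr_pwDl ?mulr_gt0 ?expR_gt0// mulr_ge0// expR_ge0.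
have [phi1 E1] := integrable_cstD P lam F.1 F1i.
have [phi2 E2] := integrable_cstD P (- lam) F.2 F2i.
rewrite F1E adde0 in E1; rewrite F2E adde0 in E2.
rewrite gz_fwd gz_bwd.
have [|||g1 g2] := @elog_mgf_super _ _ _ P pp pm T Tinv mT mTinv TK TinvK PT PTinv
  mpp mpm pp0 pm0 r a (fun w => lam + F.1 w) a0.
- by apply: filterS ap => w [].
- exact: phi1.
- near=> w.
  have F2w : F.2 w = - F.1 (Tinv w).
    apply/eqP; rewrite -addr_eq0 addrC; apply/eqP.
    by rewrite -{2}[w]TinvK; near: w.
  by rewrite opprD -F2w; near: w.
have [|||h1 h2] := @elog_mgf_super _ _ _ P pm pp Tinv T mTinv mT TinvK TK PTinv PT
  mpm mpp pm0 pp0 r a (fun w => - lam + F.2 w) a0.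
- by apply: filterS ap => w [].
- exact: phi2.
- near=> w.
  have F2w : F.2 (T w) = - F.1 w.
    by apply/eqP; rewrite -addr_eq0 addrC; apply/eqP; near: w.
  by rewrite opprD opprK F2w opprK addrC; near: w.
split => //.
  by rewrite (le_trans g2)// (integrable_opp P _ phi1).2 E1.
by rewrite (le_trans h2)// (integrable_opp P _ phi2).2 E2 EFinN oppeK.
Unshelve. all: by end_near. Qed.

Lemma Lambda_le lam r F : classK P T F ->
  {ae P, forall w, expR r * (pp w * expR (lam + F.1 w) + pm w * expR (- lam + F.2 w)) <= 1} ->
  {ae P, forall w, 0 < pp w} ->
  (Lambda P pp pm T lam <= (- r)%:E)%E.
Proof.
move=> KF super ppgt0; apply: ge_ereal_inf.
exists (ess_sup P (fun w => (ln (pp w * expR (lam + F.1 w)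
                               + pm w * expR (- lam + F.2 w)))%:E)).
  by exists F.
apply/ess_supP; near=> w.
have ppw : 0 < pp w by near: w.
rewrite lee_fin -[- r]expRK ler_ln ?posrE ?expR_gt0//; last first.
  by rewrite ltr_pwDl ?mulr_gt0 ?expR_gt0// mulr_ge0// expR_ge0.
by rewrite expRN -[leRHS]div1r ler_pdivlMr ?expR_gt0// mulrC; near: w.
Unshelve. all: by end_near. Qed.

Lemma Lambda_gz_fwd r : {ae P, forall w, 0 < pp w} ->
  gz P pp pm T Tinv 1 r \is a fin_num ->
  (Lambda P pp pm T (- fine (gz P pp pm T Tinv 1 r)) <= (- r)%:E)%E.
Proof.
move=> ppgt0; rewrite gz_fwd => gfin.
have [phi [phii phiE super]] := elog_mgf_solution P pp pm T Tinv mT mTinv TK TinvK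
  PTinv mpp mpm pp0 pm0 r gfin.
set g := fine _.
have gE : (\int[P]_w (phi w)%:E = (- g)%:E)%E by rewrite phiE EFinN fineK.
have [F1i F1E] := integrable_cstD P g phi phii.
have [F2i F2E] := integrable_opp P _ F1i.
(* F^+ is phi centred, and the cocycle relation then forces F^-. With lam = - g the exponents become
   phi and - phi o [Tinv]. *)
apply: (Lambda_le _ _ (fun w => g + phi w, fun w => - (g + phi (Tinv w)))) => //.
  split => /=.
  - exact: F1i.
  - exact: (integrable_measure_preserving P Tinv _ mTinv PTinv F2i).
  - by rewrite F1E gE -EFinD addrN.
  - rewrite (integral_measure_preserving P Tinv _ mTinv PTinv F2i) /= F2E F1E gE.
    by rewrite -EFinD addrN oppe0.
  - by apply: aeW => w; rewrite TK addrN.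
by apply: filterS super => w; rewrite /= opprK opprD addKr addNKr.
Qed.

Lemma Lambda_gz_bwd r : {ae P, forall w, 0 < pp w} ->
  gz P pp pm T Tinv (-1) r \is a fin_num ->
  (Lambda P pp pm T (fine (gz P pp pm T Tinv (-1) r)) <= (- r)%:E)%E.
Proof.
move=> ppgt0; rewrite gz_bwd => hfin.
have [phi [phii phiE super]] := elog_mgf_solution P pm pp Tinv T mTinv mT TinvK TK
  PT mpm mpp pm0 pp0 r hfin.
set h := fine _.
have hE : (\int[P]_w (phi w)%:E = (- h)%:E)%E by rewrite phiE EFinN fineK.
have [F2i F2E] := integrable_cstD P h phi phii.
have [F1i F1E] := integrable_opp P _ F2i.
(* In the reflected case F^- is the centred phi and F^+ is forced. With lam = h the exponents become
   - phi o [T] and phi. *)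
apply: (Lambda_le _ _ (fun w => - (h + phi (T w)), fun w => h + phi w)) => //.
  split => /=.
  - exact: (integrable_measure_preserving P T _ mT PT F1i).
  - exact: F2i.
  - rewrite (integral_measure_preserving P T _ mT PT F1i) /= F1E F2E hE.
    by rewrite -EFinD addrN oppe0.
  - by rewrite F2E hE -EFinD addrN.
  - by apply: aeW => w; rewrite addNr.
apply: filterS super => w; rewrite /= opprD addKr addNKr.
by rewrite addrC.
Qed.

End rate_functions.

(** * Comparison of the two suprema *)

Lemma le_sub_ereal_real {R : realType} (y : R) (L J : \bar R) :
  (forall r : R, (L < (- r)%:E)%E -> ((y + r)%:E <= J)%E) -> (y%:E - L <= J)%E.
Proof.
move=> H; case: L H => [l| |] H /=.
- apply/lee_addgt0Pr => e e0; rewrite -leeBlDr//.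
  have := H (- l - e); rewrite lte_fin opprD !opprK ltrDl => /(_ e0).
  by rewrite addrA.
- by rewrite addeNy leNye.
- have {}H r : ((y + r)%:E <= J)%E by apply: H; rewrite ltNyr.
  case: J H => [j| |] H; [|by rewrite leey|].
    (* If L is -oo, r is arbitrary; this choice of r would give j + 1 <= j. *)
    by exfalso; move: (H (j - y + 1)) => {H}; rewrite lee_fin; lra.
  by have := H 0; rewrite leeNy_eq.
Qed.

Theorem theorem5p4 (R : realType) (d : measure_display) (Omega : measurableType d)
  (P : probability Omega R) (T Tinv : Omega -> Omega) (pp pm : Omega -> R) :
  measurable_fun setT T -> measurable_fun setT Tinv ->
  cancel T Tinv -> cancel Tinv T ->
  (forall A, measurable A -> P (T @^-1` A) = P A) ->
  (forall A, measurable A -> T @^-1` A = A -> P A = 0%E \/ P A = 1%E) ->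
  measurable_fun setT pp -> measurable_fun setT pm ->
  (forall w, 0 <= pp w <= 1) -> (forall w, 0 <= pm w <= 1) ->
  (forall w, pp w + pm w = 1) ->
  (exists a b : R, [/\ 0 < a, b < 1 &
     {ae P, forall w, a <= pp w <= b /\ a <= pm w <= b}]) ->
  (\int[P]_w (ln (pm w / pp w))%:E <= 0)%E ->
  forall x : R, -1 <= x <= 1 ->
    Irate P pp pm T x = Jrate P pp pm T Tinv x.
Proof.
move=> mT mTinv TK TinvK PT _ mpp mpm pp01 pm01 _ [a [b [a0 _ ab]]] _ x _.
have pp0 w : 0 <= pp w by case/andP: (pp01 w).
have pm0 w : 0 <= pm w by case/andP: (pm01 w).
have ap : {ae P, forall w, a <= pp w /\ a <= pm w}.
  by apply: filterS ab => w [/andP[? _] /andP[? _]].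
have ppgt0 : {ae P, forall w, 0 < pp w}.
  by apply: filterS ap => w [+ _]; exact: lt_le_trans.
have super lam r : (Lambda P pp pm T lam < (- r)%:E)%E ->
  [/\ gz P pp pm T Tinv 1 r \is a fin_num,
      (gz P pp pm T Tinv 1 r <= (- lam)%:E)%E,
      gz P pp pm T Tinv (-1) r \is a fin_num &
      (gz P pp pm T Tinv (-1) r <= lam%:E)%E].
  (* Strictness turns the infimum into an actual corrector [F] with essential supremum below - r. *)
  move=> /ereal_inf_lt[_ [F KF <-]] /ltW /ess_supP Fr.
  exact: (gz_super P T Tinv pp pm mT mTinv TK TinvK PT mpp mpm pp0 pm0 a lam r F).
apply/eqP; rewrite eq_le; apply/andP; split.
  (* I <= J: for each r with Lambda(lam) < - r, h(r) <= lam <= - g(r). Multiplying by x, lam x is at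
     most - x g(r) if x >= 0, and at most x h(r) if x < 0. *)
  apply: ge_ereal_sup => _ [lam _ <-]; apply: le_sub_ereal_real => r.
  move=> /super[gfin gle hfin hle]; rewrite /Jrate; case: ifP => x0.
    apply: le_trans (ereal_sup_ubound _); last by exists r.
    rewrite gfin lee_fin addrC lerD2l -[leLHS]opprK lerN2 -mulNr mulrC.
    by rewrite ler_wpM2r// -lee_fin fineK.
  apply: le_trans (ereal_sup_ubound _); last by exists r.
  rewrite hfin lee_fin addrC lerD2l mulrC ler_wnM2l//.
    by rewrite ltW// ltNge x0.
  by rewrite -lee_fin fineK.
have Ile lam r : (Lambda P pp pm T lam <= (- r)%:E)%E ->
    ((lam * x + r)%:E <= Irate P pp pm T x)%E.
  move=> lamr; apply: le_trans (ereal_sup_ubound _); last by exists lam.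
  by rewrite EFinD leeD2l// leeNr.
(* J <= I: a finite g(r) or h(r) supplies lam = - g(r) or lam = h(r) with Lambda(lam) <= - r; the
   other terms are -oo. *)
rewrite /Jrate; case: ifP => _; apply: ge_ereal_sup => _ [r _ <-].
  case: ifPn => [gfin|]; last by rewrite leNye.
  have := Ile _ _ (Lambda_gz_fwd P T Tinv pp pm mT mTinv TK TinvK PT mpp mpm pp0 pm0 r ppgt0 gfin).
  by rewrite mulNr addrC [_ * x]mulrC.
case: ifPn => [hfin|]; last by rewrite leNye.
have := Ile _ _ (Lambda_gz_bwd P T Tinv pp pm mT mTinv TK TinvK PT mpp mpm pp0 pm0 r ppgt0 hfin).
by rewrite addrC [_ * x]mulrC.
Qed.
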